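(* Let $X\subseteq 2^\omega$ be an uncountable saturated $\lambda$-set. Then $X$ is a relatively countable dense homogeneous subspace of $2^\omega$; that is, for all countable dense subsets $D_0, D_1$ of $X$ there is a homeomorphism $h\colon 2^\omega\to 2^\omega$ such that (1) $h[D_0]=D_1$, and (2) $h[X]=X$.
   Context: $2^\omega$ is the Cantor set of infinite binary sequences with the product topology. A $\lambda$-set is a subset $X$ of $2^\omega$ such that every countable subset of $X$ is a relative $G_\delta$ subset of $X$. For $x,y\in 2^\omega$ write $x\sim y$ (tail equivalence) if there are $m,n\in\omega$ such that $x(m+k)=y(n+k)$ for all $k\in\omega$. For $X\subseteq 2^\omega$ let $X^*=\{y\in 2^\omega:\exists x\in X\ (y\sim x)\}$. The set $X$ is saturated if $X=X^*$. *)

(* Defs.v *)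
From mathcomp Require Import all_boot all_order all_algebra.
From mathcomp Require Import all_classical all_reals all_analysis.
From mathcomp Require Import borel_hierarchy.

Set Implicit Arguments.
Unset Strict Implicit.
Unset Printing Implicit Defensive.

Local Open Scope classical_set_scope.

Section topological_notions.
Context {T : topologicalType}.
Implicit Types X A D : set T.

Definition relative_Gdelta X A := exists2 G : set T, Gdelta G & A = X `&` G.

(* As usual, [countable] includes the finite sets. *)
Definition lambda_set X :=
  forall A, A `<=` X -> countable A -> relative_Gdelta X A.

(* Density for the subspace topology of X. The library's [dense] over
   [subspace X] would not do: there, points outside X are isolated. *)
Definition dense_subset X D := D `<=` X /\ X `<=` closure D.

Definition homeomorphism {U : topologicalType} (h : T -> U) :=
  continuous h /\
  exists g : U -> T, [/\ cancel h g, cancel g h & continuous g].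

Definition relatively_cdh X :=
  forall D0 D1 : set T,
    countable D0 -> dense_subset X D0 ->
    countable D1 -> dense_subset X D1 ->
    exists h : T -> T, [/\ homeomorphism h, h @` D0 = D1 & h @` X = X].

End topological_notions.

Definition tail_equiv (x y : cantor_space) :=
  exists m n : nat, forall k : nat, x (m + k)%N = y (n + k)%N.

Definition saturation (X : set cantor_space) : set cantor_space :=
  [set y | exists2 x, X x & tail_equiv y x].

Definition saturated (X : set cantor_space) := X = saturation X.

(* Main.v *)
(** Let E be D0 union D1, choose x0 in X outside the saturation of E (X is
    uncountable), and let D be the saturation of E together with x0. Then D is
    countable and each of D0, D1, D \ D0, D \ D1 is dense. Since X is a
    lambda-set, X \ D is covered by an increasing sequence of closed sets F n
    disjoint from D. The homeomorphism is a limit of homeomorphisms g_n moving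
    every point inside its tail class. A back-and-forth argument produces pairs
    (a, b) in D x D with (a in D0 iff b in D1); each pair comes with a cone
    around b to be kept as the image of a neighbourhood of a. Stage n alters
    g_n only by exchanging the cones of g_n(a) and b inside the cone of such a
    pair, and these cones and their preimages avoid F n. So both the limit and
    its inverse are tail equivalences on each F n, hence preserve X \ D by
    saturation, while the pairs make the limit map D onto D and D0 onto D1. *)
Require Import Defs.
From mathcomp Require Import all_boot all_order all_algebra.
From mathcomp Require Import all_classical all_reals all_analysis.
From Stdlib Require List.

Set Implicit Arguments.
Unset Strict Implicit.
Unset Printing Implicit Defensive.

Local Open Scope classical_set_scope.

(** * Finite prefixes, cone exchanges and continuity read on prefixes *)

Local Notation point := (nat -> bool).

Definition pre (k : nat) (x : point) : seq bool := mkseq x k.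

Definition splice (k : nat) (u y : point) : point :=
  fun i => if i < k then u i else y i.

(** The exchange of the cones of length [k] around [u] and [v]. Only the first [k] bits change, so
    tail classes are kept; if the cones coincide it is the identity. *)
Definition swap (k : nat) (u v y : point) : point :=
  if pre k y == pre k u then splice k v y
  else if pre k y == pre k v then splice k u y else y.

(** Continuity for the product topology, phrased on prefixes to keep the construction combinatorial;
    [continuous_cantorP] translates it. *)
Definition pcontinuous (g : point -> point) :=
  forall x m, exists k, forall y, pre k x = pre k y -> pre m (g x) = pre m (g y).

Lemma preP k x y : pre k x = pre k y <-> (forall i, i < k -> x i = y i).
Proof.
split=> [xy i ik|xy].
  by rewrite -(nth_mkseq false x ik) -/(pre k x) xy /pre nth_mkseq.
apply: (@eq_from_nth _ false); rewrite /pre !size_mkseq // => i ik.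
by rewrite !nth_mkseq // xy.
Qed.

Lemma pre_le m k x y : m <= k -> pre k x = pre k y -> pre m x = pre m y.
Proof. by move=> mk /preP xy; apply/preP => i im; apply/xy/(leq_trans im). Qed.

Lemma pre_inj x y : (forall k, pre k x = pre k y) -> x = y.
Proof. by move=> xy; apply: funext => i; have /preP := xy i.+1; apply. Qed.

Lemma pre_splice k u y : pre k (splice k u y) = pre k u.
Proof. by apply/preP => i ik; rewrite /splice ik. Qed.

Lemma splice_id k u y : pre k u = pre k y -> splice k u y = y.
Proof.
by move=> /preP uy; apply: funext => i; rewrite /splice; case: ifPn => // /uy.
Qed.

Lemma splice_splice k u v y : splice k u (splice k v y) = splice k u y.
Proof. by apply: funext => i; rewrite /splice; case: (i < k). Qed.

Lemma swapK k u v : involutive (swap k u v).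
Proof.
move=> y; rewrite {2}/swap; case: eqP => [yu|/eqP/negPf yu].
  rewrite /swap pre_splice; case: eqP => [vu|_].
    by rewrite splice_splice; apply: splice_id; rewrite vu yu.
  by rewrite eqxx splice_splice; apply: splice_id; rewrite yu.
case: eqP => [yv|/eqP/negPf yv]; last by rewrite /swap yu yv.
by rewrite /swap pre_splice eqxx splice_splice; apply: splice_id; rewrite yv.
Qed.

Lemma pre_swapl k u v y : pre k y = pre k u -> pre k (swap k u v y) = pre k v.
Proof. by rewrite /swap => ->; rewrite eqxx pre_splice. Qed.

Lemma pre_swapr k u v y : pre k y = pre k v -> pre k (swap k u v y) = pre k u.
Proof.
rewrite /swap => ->; case: eqP => [vu|_]; first by rewrite pre_splice.
by rewrite eqxx pre_splice.
Qed.

Lemma pcontinuous_comp f g :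
  pcontinuous f -> pcontinuous g -> pcontinuous (f \o g).
Proof.
move=> cf cg x m; have [k fk] := cf (g x) m; have [l gl] := cg x k.
by exists l => y /gl /fk.
Qed.

Lemma pcontinuous_if k (s : seq bool) f g :
  pcontinuous f -> pcontinuous g ->
  pcontinuous (fun y => if pre k y == s then f y else g y).
Proof.
move=> cf cg x m; have [a fa] := cf x m; have [b gb] := cg x m.
exists (k + a + b) => y xy.
have -> : pre k x = pre k y by apply: pre_le xy; rewrite -addnA leq_addr.
case: ifP => _; [apply: fa|apply: gb]; apply: pre_le xy.
  by rewrite addnAC leq_addl.
by rewrite leq_addl.
Qed.

Lemma pcontinuous_id : pcontinuous id.
Proof. by move=> x m; exists m. Qed.

Lemma pcontinuous_splice k u : pcontinuous (splice k u).
Proof.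
move=> x m; exists m => y /preP xy; apply/preP => i im.
by rewrite /splice; case: ifP => // _; apply: xy.
Qed.

Lemma pcontinuous_swap k u v : pcontinuous (swap k u v).
Proof.
apply: pcontinuous_if; first exact: pcontinuous_splice.
by apply: pcontinuous_if; [exact: pcontinuous_splice|exact: pcontinuous_id].
Qed.

(** * Tail equivalence and homeomorphisms that respect it *)

Lemma tail_equiv_refl x : tail_equiv x x.
Proof. by exists 0, 0. Qed.

Lemma tail_equiv_sym x y : tail_equiv x y -> tail_equiv y x.
Proof. by move=> [m [n xy]]; exists n, m. Qed.

Lemma tail_equiv_trans x y z :
  tail_equiv x y -> tail_equiv y z -> tail_equiv x z.
Proof.
move=> [m [n xy]] [m' [n' yz]]; exists (m + m'), (n' + n) => k.
by rewrite -addnA xy addnCA yz addnA.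
Qed.

Lemma tail_equiv_splice k u y : tail_equiv (splice k u y) y.
Proof. by exists k, k => i; rewrite /splice ltnNge leq_addr. Qed.

Lemma tail_equiv_swap k u v y : tail_equiv (swap k u v y) y.
Proof.
rewrite /swap; case: ifP => _; first exact: tail_equiv_splice.
by case: ifP => _; [exact: tail_equiv_splice|exact: tail_equiv_refl].
Qed.

Record tail_homeo (g g' : point -> point) : Prop := TailHomeo {
  thK : cancel g g';
  thK' : cancel g' g;
  th_cont : pcontinuous g;
  th_cont' : pcontinuous g';
  th_tail : forall x, tail_equiv (g x) x }.

Lemma tail_homeo_comp f f' g g' :
  tail_homeo f f' -> tail_homeo g g' -> tail_homeo (f \o g) (g' \o f').
Proof.
move=> [fK fK' cf cf' tf] [gK gK' cg cg' tg]; split.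
- exact: can_comp.
- exact: can_comp.
- exact: pcontinuous_comp.
- exact: pcontinuous_comp.
- by move=> x; apply: tail_equiv_trans (tf _) (tg _).
Qed.

(** * Commitments and simultaneous cone exchanges *)

(* A promise that the cone around [tgt] of length [depth] stays the image of
   a small neighbourhood of [src], so that the limit maps [src] to [tgt]. *)
Record commitment := Commit { src : point; tgt : point; depth : nat }.

Definition in_cone p y := pre (depth p) y == pre (depth p) (tgt p).

Definition disjoint_cones (L : list commitment) := forall p q y,
  List.In p L -> List.In q L -> in_cone p y -> in_cone q y -> p = q.

Fixpoint patch (g : point -> point) K (L : list commitment) y : point :=
  if L is p :: L' then
    if in_cone p y then swap K (g (src p)) (tgt p) y else patch g K L' y
  else y.

Lemma patch_id g K L y : (forall p, List.In p L -> ~~ in_cone p y) -> patch g K L y = y.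
Proof.
elim: L => //= p L IH yL; rewrite (negPf (yL _ (or_introl erefl))).
by apply: IH => q qL; apply: yL; right.
Qed.

Lemma patch_in g K L p y : disjoint_cones L -> List.In p L -> in_cone p y ->
  patch g K L y = swap K (g (src p)) (tgt p) y.
Proof.
move=> dL pL py; have : forall q, List.In q L -> in_cone q y -> q = p.
  by move=> q qL qy; apply: (dL _ _ y).
elim: L pL {dL} => //= q L IH pL yL; case: ifPn => [qy|qy].
  by rewrite (yL q (or_introl erefl) qy).
case: pL => [qp|pL]; first by rewrite qp py in qy.
by apply: IH => // r rL; apply: yL; right.
Qed.

Lemma pcontinuous_patch g K L : pcontinuous (patch g K L).
Proof.
elim: L => [|p L IH] /=; first exact: pcontinuous_id.
by apply: pcontinuous_if => //; exact: pcontinuous_swap.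
Qed.

Lemma tail_equiv_patch g K L y : tail_equiv (patch g K L y) y.
Proof.
elim: L => [|p L IH] /=; first exact: tail_equiv_refl.
by case: ifP => // _; exact: tail_equiv_swap.
Qed.

Lemma exists_in_cone L y :
  (exists2 p, List.In p L & in_cone p y) \/ (forall p, List.In p L -> ~~ in_cone p y).
Proof.
have [h|h] := pselect (exists2 p, List.In p L & in_cone p y); first by left.
by right=> p pL; apply/negP => py; apply: h; exists p.
Qed.

Lemma in_cone_swap p g K y : depth p <= K ->
  pre (depth p) (g (src p)) = pre (depth p) (tgt p) ->
  in_cone p y -> in_cone p (swap K (g (src p)) (tgt p) y).
Proof.
move=> pK gp /eqP py; apply/eqP; rewrite /swap.
case: ifP => _; first by apply: pre_le (pre_splice _ _ _).
by case: ifP => _ //; rewrite -gp; apply: pre_le (pre_splice _ _ _).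
Qed.

(** Both cones exchanged for [p] lie inside the cone of [p], so a second application meets the same
    exchange, which is an involution. *)
Lemma patchK g K L : disjoint_cones L ->
  (forall p, List.In p L -> depth p <= K) ->
  (forall p, List.In p L -> pre (depth p) (g (src p)) = pre (depth p) (tgt p)) ->
  involutive (patch g K L).
Proof.
move=> dL LK gL y; have [[p pL py]|yL] := exists_in_cone L y; last first.
  by rewrite !patch_id ?patch_id.
rewrite (patch_in _ _ dL pL py) (patch_in _ _ dL pL) ?swapK //.
by apply: in_cone_swap => //; [exact: LK|exact: gL].
Qed.

(** * Uniform thresholds and limits of maps *)

Lemma eventually_In (L : list commitment) (P : commitment -> nat -> Prop) :
  (forall p, List.In p L -> exists k, forall l, k <= l -> P p l) ->
  exists k, forall p, List.In p L -> forall l, k <= l -> P p l.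
Proof.
elim: L => [|p L IH] PL; first by exists 0.
have [k Pk] := PL p (or_introl erefl).
have [|k' Pk'] := IH; first by move=> q qL; apply: PL; right.
exists (maxn k k') => q [<-|qL] l; rewrite geq_max => /andP[kl k'l].
  exact: Pk.
exact: Pk'.
Qed.

Lemma eventually_and (P Q : nat -> Prop) :
  (exists k, forall l, k <= l -> P l) -> (exists k, forall l, k <= l -> Q l) ->
  exists k, forall l, k <= l -> P l /\ Q l.
Proof.
move=> [k Pk] [k' Qk']; exists (maxn k k') => l.
by rewrite geq_max => /andP[/Pk ? /Qk'].
Qed.

Lemma pre_neq x y : x <> y -> exists k, forall l, k <= l -> pre l x <> pre l y.
Proof.
move=> xy; apply: contrapT => h; apply: xy; apply: pre_inj => k.
apply: contrapT => xy; apply: h; exists k => l kl.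
by move/(pre_le kl).
Qed.

(** Bit [i] of the limit is read off [g i.+1], whose first [i.+1] bits are final. The convergence is
    uniform in [x], hence continuity survives. *)
Lemma pre_limit (g : nat -> point -> point) :
  (forall n, pcontinuous (g n)) ->
  (forall n x, pre n (g n.+1 x) = pre n (g n x)) ->
  exists2 h, pcontinuous h & forall n x, pre n (h x) = pre n (g n x).
Proof.
move=> cg gS.
have gle n m x : n <= m -> pre n (g m x) = pre n (g n x).
  elim: m => [|m IH]; first by rewrite leqn0 => /eqP ->.
  rewrite leq_eqVlt => /predU1P[->//|nm].
  by rewrite -IH //; exact: pre_le (gS m x).
pose h x i := g i.+1 x i.
have hg n x : pre n (h x) = pre n (g n x).
  by apply/preP => i ni; have /preP/(_ i (ltnSn i)) := gle _ _ x ni.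
exists h => // x m; have [k gk] := cg m x m.
by exists k => y /gk; rewrite !hg.
Qed.

(** * The back-and-forth construction *)

Section BackAndForth.
Context (D D0 D1 : set point) (F : nat -> set point).
Context (D_sat : forall x y, D x -> tail_equiv y x -> D y).
Context (F_mono : forall n, F n `<=` F n.+1).
Context (F_away : forall n d, D d ->
  exists k, forall x, pre k d = pre k x -> ~ F n x).
Context (D0_dense : forall k x (b : Prop),
  exists y, [/\ D y, D0 y <-> b & pre k x = pre k y]).
Context (D1_dense : forall k x (b : Prop),
  exists y, [/\ D y, D1 y <-> b & pre k x = pre k y]).

(** [v_depth] makes the forward maps converge uniformly, and [v_small] the inverse maps. [v_F']
    freezes the forward map on [F n], and [v_F] freezes the inverse there. *)
Record valid n (g : point -> point) p : Prop := Valid {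
  v_src : D (src p);
  v_tgt : D (tgt p);
  v_type : D0 (src p) <-> D1 (tgt p);
  v_near : in_cone p (g (src p));
  v_depth : n <= depth p;
  v_small : forall x, in_cone p (g x) -> pre n (src p) = pre n x;
  v_F : forall x, F n x -> ~~ in_cone p x;
  v_F' : forall x, F n x -> ~~ in_cone p (g x) }.

Record state := State {
  fwd : point -> point;
  bwd : point -> point;
  promises : list commitment }.

Record good n s : Prop := Good {
  g_homeo : tail_homeo (fwd s) (bwd s);
  g_valid : forall p, List.In p (promises s) -> valid n (fwd s) p;
  g_disj : disjoint_cones (promises s) }.

Record step s s' : Prop := Step {
  s_near : forall x, fwd s' x = fwd s x \/
    exists2 p, List.In p (promises s) & in_cone p (fwd s x) /\ in_cone p (fwd s' x);
  s_keep : forall p, List.In p (promises s) ->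
    exists2 p', List.In p' (promises s') & src p' = src p /\ tgt p' = tgt p }.

Lemma tail_homeo_cont' g g' : tail_homeo g g' -> forall x m,
  exists k, forall l, k <= l ->
    forall y, pre l (g y) = pre l (g x) -> pre m x = pre m y.
Proof.
move=> [gK _ _ cg' _] x m; have [k gk] := cg' (g x) m.
exists k => l kl y; rewrite -{2}(gK x) -{2}(gK y) => xy.
by apply: gk; apply: pre_le (esym xy).
Qed.

Lemma F_away_homeo g g' n a : tail_homeo g g' -> D a ->
  exists k, forall l, k <= l ->
    forall x, F n x -> pre l (g x) <> pre l (g a).
Proof.
move=> th Da; have [k Fk] := F_away n Da.
have [l gl] := tail_homeo_cont' th a k.
by exists l => m lm x Fx xa; apply: (Fk x) => //; apply: gl xa.
Qed.

(** Exchanging the cones of a large length [k] around [g (src p)] and [tgt p] brings the image of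
    [src p] into the smaller cone of [tgt p]. Every promise then shrinks its cone to length [k]. *)
Lemma refine_state n s a b : good n s -> exists s',
  [/\ good n.+1 s', step s s',
      forall p, List.In p (promises s') -> in_cone p (fwd s' a) -> src p = a &
      forall p, List.In p (promises s') -> in_cone p b -> tgt p = b].
Proof.
case: s => g g' L [/= th vL dL].
(* The first five conditions serve validity at [n.+1]; the last two isolate [a] and [b] from other
   sources and targets. All hold for every large [K], so one length serves the finite list. *)
pose P p K := [/\ n.+1 <= K, depth p <= K,
  (forall x, pre K (g x) = pre K (g (src p)) -> pre n.+1 (src p) = pre n.+1 x),
  (forall x, F n.+1 x -> pre K x <> pre K (tgt p)) &
  (forall x, F n.+1 x -> pre K (g x) <> pre K (g (src p)))] /\
  ((pre K (g a) = pre K (g (src p)) -> src p = a) /\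
  (pre K b = pre K (tgt p) -> tgt p = b)).
have [k Pk] : exists k, forall p, List.In p L -> forall l, k <= l -> P p l.
  apply: eventually_In => p pL; have [Da Db _ _ _ _ _ _] := vL p pL.
  apply: eventually_and; last first.
    apply: eventually_and.
      have [/(can_inj (thK th))->|/pre_neq[l gl]] := pselect (g a = g (src p)).
        by exists 0.
      by exists l => m /gl.
    have [->|/pre_neq[l gl]] := pselect (b = tgt p); first by exists 0.
    by exists l => m /gl.
  have [k1 h1] := tail_homeo_cont' th (src p) n.+1.
  have [k2 h2] := F_away n.+1 Db.
  have [k3 h3] := F_away_homeo n.+1 th Da.
  exists (n.+1 + depth p + k1 + k2 + k3) => l kl; split.
  - by apply: leq_trans kl; rewrite -!addnA leq_addr.
  - by apply: leq_trans kl; rewrite -!addnA addnCA leq_addr.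
  - by apply: h1; apply: leq_trans kl; rewrite -addnA addnAC leq_addl.
  - move=> x Fx xb; apply: (h2 x) => //; apply: pre_le (esym xb).
    by apply: leq_trans kl; rewrite addnAC leq_addl.
  - by apply: h3; apply: leq_trans kl; rewrite leq_addl.
have {}Pk p (pL : List.In p L) : P p k by apply: Pk.
pose f := patch g k L; pose L' := List.map (fun p => Commit (src p) (tgt p) k) L.
have fK : involutive f.
  apply: patchK => // p pL; first by have [[]] := Pk p pL.
  by apply/eqP; exact: v_near (vL p pL).
have coarse p y : List.In p L -> pre k y = pre k (tgt p) -> in_cone p y.
  by move=> pL py; apply/eqP; apply: pre_le py; have [[]] := Pk p pL.
have coarse' p y : List.In p L -> pre k y = pre k (g (src p)) -> in_cone p y.
  move=> pL py; apply/eqP; rewrite -(eqP (v_near (vL p pL))).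
  by apply: pre_le py; have [[]] := Pk p pL.
(* Points that [f] sends into the shrunken cone of [p] come from the cone of [g (src p)]: claims
   about preimages under [f \o g] reduce to [g]. *)
have fr p y : List.In p L -> pre k (f y) = pre k (tgt p) -> pre k y = pre k (g (src p)).
  move=> pL py; rewrite -(fK y) /f (patch_in _ _ dL pL); last exact: coarse.
  exact: pre_swapr.
exists (State (f \o g) (g' \o f) L'); split=> /=.
- split=> /=.
  + apply: tail_homeo_comp => //; split => //.
    * exact: pcontinuous_patch.
    * exact: pcontinuous_patch.
    * by move=> x; exact: tail_equiv_patch.
  + move=> _ /List.in_map_iff[p [<- pL]]; have v := vL p pL.
    have [[nk pk h1 h2 h3] [h4 h5]] := Pk p pL.
    split=> //=; try by case: v.
    * rewrite /in_cone /=; apply/eqP.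
      rewrite /f (patch_in _ _ dL pL); first exact: pre_swapl.
      exact: v_near v.
    * by move=> x /eqP /(fr _ _ pL) /h1.
    * by move=> x Fx; apply/eqP; exact: h2.
    * by move=> x Fx; apply/eqP => /(fr _ _ pL); exact: h3.
  + move=> _ _ y /List.in_map_iff[p [<- pL]] /List.in_map_iff[q [<- qL]] /eqP py /eqP qy.
    by rewrite (dL p q y) //; exact: coarse.
- split=> [x|p pL] /=; last first.
    by exists (Commit (src p) (tgt p) k) => //; apply/List.in_map_iff; exists p.
  have [[p pL px]|gL] := exists_in_cone L (g x); last by left; exact: patch_id.
  right; exists p => //; split=> //; rewrite /f (patch_in _ _ dL pL) //.
  apply: in_cone_swap => //; first by have [[]] := Pk p pL.
  by apply/eqP; exact: v_near (vL p pL).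
- move=> _ /List.in_map_iff[p [<- pL]] /eqP /= /(fr _ _ pL).
  by have [_ []] := Pk p pL.
- move=> _ /List.in_map_iff[p [<- pL]] /eqP /=.
  by have [_ []] := Pk p pL.
Qed.

(** [K] is fixed before [a] and [b], because density supplies the missing partner only once a cone
    is prescribed. *)
Lemma add_commitment n s y : good n s -> D y ->
  (forall p, List.In p (promises s) -> ~~ in_cone p y) ->
  exists K, forall a b, D a -> D b -> (D0 a <-> D1 b) ->
    pre K y = pre K (fwd s a) -> pre K y = pre K b ->
  good n (State (fwd s) (bwd s) (Commit a b K :: promises s)).
Proof.
case: s => g g' L [/= th vL dL] Dy yL.
have [k1 h1] := F_away n Dy.
have Dgy : D (g' y).
  apply: D_sat Dy _; have := th_tail th (g' y).
  by rewrite (thK' th); exact: tail_equiv_sym.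
have [k2 h2] := F_away_homeo n th Dgy.
have [k3 h3] := tail_homeo_cont' th (g' y) n.
have [k4 h4] : exists k, forall p, List.In p L -> forall l, k <= l -> depth p <= l.
  by apply: eventually_In => p _; exists (depth p).
rewrite (thK' th) in h2 h3.
pose K := n + k1 + k2 + k3 + k4.
have hn : n <= K by rewrite /K -!addnA leq_addr.
have hk1 : k1 <= K by rewrite /K -!addnA addnCA leq_addr.
have hk2 : k2 <= K by rewrite /K -addnA addnAC leq_addl.
have hk3 : k3 <= K by rewrite /K addnAC leq_addl.
have hk4 : k4 <= K by rewrite /K leq_addl.
exists K => a b Da Db ab ya yb.
(* As [K] is at least every old depth, an old cone meeting the new one would contain it, and with it
   [y]. *)
have new p z : List.In p L -> in_cone p z -> pre K z <> pre K b.
  move=> pL /eqP pz zb; have /negP := yL p pL; apply; apply/eqP.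
  by rewrite -pz; apply: (@pre_le _ K); [exact: h4|rewrite yb zb].
split=> //=.
- move=> p [<-|/vL//]; split=> //=.
  + by rewrite /in_cone/= -ya yb.
  + move=> x /eqP /=; rewrite -yb => xy.
    by rewrite -(h3 _ hk3 x xy) -(h3 _ hk3 a).
  + move=> x Fx; apply/eqP => /=; rewrite -yb => xy.
    by apply: (h1 x) Fx; apply: pre_le (esym xy).
  + by move=> x Fx; apply/eqP => /=; rewrite -yb; exact: h2.
- move=> p q z [<-|pL] [<-|qL] //; last exact: dL.
  + by move=> /eqP /= zb /(new _ _ qL).
  + by move=> /(new _ _ pL) zb /eqP.
Qed.

(** Refinement raises the index to [n.+1]. If the image of [a] then lies in a promised cone, [a] is
    already a source; otherwise a target of the right type is taken near that image. *)
Lemma forth n s a : good n s -> D a -> exists s',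
  [/\ good n.+1 s', step s s' & exists2 p, List.In p (promises s') & src p = a].
Proof.
move=> gs Da; have [s1 [gs1 [near keep] ha _]] := refine_state a a gs.
have [[p pL pa]|aL] := exists_in_cone (promises s1) (fwd s1 a).
  by exists s1; split=> //; exists p => //; exact: ha.
have Dga : D (fwd s1 a) := D_sat Da (th_tail (g_homeo gs1) a).
have [K hK] := add_commitment gs1 Dga aL.
have [b [Db ab yb]] := D1_dense K (fwd s1 a) (D0 a).
exists (State (fwd s1) (bwd s1) (Commit a b K :: promises s1)); split.
- by apply: hK => //; split => /ab.
- by split=> //= p /keep[q qL qp]; exists q => //; right.
- by exists (Commit a b K) => //; left.
Qed.

(** Mirror image of [forth]: by continuity, a source close enough to [bwd s1 b] has its image in the
    prescribed cone of [b]. *)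
Lemma back n s b : good n s -> D b -> exists s',
  [/\ good n.+1 s', step s s' & exists2 p, List.In p (promises s') & tgt p = b].
Proof.
move=> gs Db; have [s1 [gs1 [near keep] _ hb]] := refine_state b b gs.
have [[p pL pb]|bL] := exists_in_cone (promises s1) b.
  by exists s1; split=> //; exists p => //; exact: hb.
have [K hK] := add_commitment gs1 Db bL.
have [k gk] := th_cont (g_homeo gs1) (bwd s1 b) K.
have [a [Da ab ya]] := D0_dense k (bwd s1 b) (D1 b).
exists (State (fwd s1) (bwd s1) (Commit a b K :: promises s1)); split.
- apply: hK => //.
  by rewrite -(thK' (g_homeo gs1) b); exact: gk.
- by split=> //= p /keep[q qL qp]; exists q => //; right.
- by exists (Commit a b K) => //; left.
Qed.

Lemma step_near_bwd n s s' : good n s -> good n.+1 s' -> step s s' -> forall y,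
  bwd s' y = bwd s y \/ exists2 p, List.In p (promises s) &
    in_cone p y /\ in_cone p (fwd s (bwd s' y)).
Proof.
move=> gs gs' [near _] y; have := near (bwd s' y).
rewrite (thK' (g_homeo gs')) => -[E|[p pL [h1 h2]]]; last by right; exists p.
by left; rewrite [in RHS]E (thK (g_homeo gs)).
Qed.

Lemma step_fwd n s s' : good n s -> step s s' -> forall x,
  pre n (fwd s' x) = pre n (fwd s x) /\ (F n x -> fwd s' x = fwd s x).
Proof.
move=> gs st x; have [->//|[p /(g_valid gs) v [h1 h2]]] := s_near st x.
split=> [|/(v_F' v)]; last by rewrite h1.
by apply: (pre_le (v_depth v)); rewrite (eqP h1) (eqP h2).
Qed.

(** If the preimage of [y] changes, [fwd s] sends the old and the new one into a common promised
    cone, and by [v_small] both share [n] bits with its source. *)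
Lemma step_bwd n s s' : good n s -> good n.+1 s' -> step s s' -> forall y,
  pre n (bwd s' y) = pre n (bwd s y) /\ (F n y -> bwd s' y = bwd s y).
Proof.
move=> gs gs' st y.
have [->//|[p /(g_valid gs) v [h1 h2]]] := step_near_bwd gs gs' st y.
split=> [|/(v_F v)]; last by rewrite h1.
rewrite -(v_small v h2); apply: (v_small v).
by rewrite (thK' (g_homeo gs)).
Qed.

Context (e : nat -> point).
Context (e_D : forall n, D (e n)).
Context (e_surj : forall d, D d -> exists n, e n = d).

Lemma back_and_forth : exists S : nat -> state, forall n,
  [/\ good n (S n), step (S n) (S n.+1) &
    exists2 p, List.In p (promises (S n.+1)) &
      if odd n then tgt p = e n./2 else src p = e n./2].
Proof.
pose R n s s' := [/\ good n.+1 s', step s s' &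
    exists2 p, List.In p (promises s') &
      if odd n then tgt p = e n./2 else src p = e n./2].
(* [choice] needs a total relation; at a state that is not good the implication is vacuous and any
   value will do. *)
have next (ns : nat * state) : exists s', good ns.1 ns.2 -> R ns.1 ns.2 s'.
  case: ns => n s /=; have [gs|ngs] := pselect (good n s); last by exists s.
  have [on|on] := boolP (odd n).
    by have [s' H] := back gs (e_D n./2); exists s' => _; rewrite /R on.
  by have [s' H] := forth gs (e_D n./2); exists s' => _; rewrite /R (negPf on).
have [N NR] := choice next.
pose S := nat_rect (fun=> state) (State id id [::]) (fun n s => N (n, s)).
have gS n : good n (S n).
  elim: n => [|n IH]; last by have [] := NR (n, S n) IH.
  split=> //=; split=> //; try exact: pcontinuous_id.
  exact: tail_equiv_refl.
by exists S => n; have [_ st p] := NR (n, S n) (gS n); split.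
Qed.

Lemma back_and_forth_limit : exists h h' : point -> point,
  [/\ cancel h h', cancel h' h, pcontinuous h & pcontinuous h'] /\
  [/\ forall d, D d -> D (h d) /\ (D0 d <-> D1 (h d)),
      forall d, D d -> D (h' d),
      forall n x, F n x -> tail_equiv (h x) x &
      forall n x, F n x -> tail_equiv (h' x) x].
Proof.
have [S HS] := back_and_forth.
have gS n : good n (S n) by case: (HS n).
have sS n : step (S n) (S n.+1) by case: (HS n).
have th n := g_homeo (gS n).
have [h ch hS] := pre_limit (fun n => th_cont (th n))
  (fun n x => (step_fwd (gS n) (sS n) x).1).
have [h' ch' hS'] := pre_limit (fun n => th_cont' (th n))
  (fun n x => (step_bwd (gS n) (gS n.+1) (sS n) x).1).
(* At stage [k + m] the forward map agrees with [h] on [k] bits, enough for the modulus of [h'] at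
   [h x], and the inverse agrees with [h'] on [m] bits. *)
have hK : cancel h h'.
  move=> x; apply: pre_inj => m; have [k hk] := ch' (h x) m.
  have le := leq_addr m k; have le' := leq_addl k m.
  rewrite (hk (fwd (S (k + m)) x)); last exact: pre_le (hS _ _).
  by rewrite (pre_le le' (hS' _ _)) (thK (th _)).
have hK' : cancel h' h.
  move=> x; apply: pre_inj => m; have [k hk] := ch (h' x) m.
  have le := leq_addr m k; have le' := leq_addl k m.
  rewrite (hk (bwd (S (k + m)) x)); last exact: pre_le (hS' _ _).
  by rewrite (pre_le le' (hS _ _)) (thK' (th _)).
have hF n x : F n x -> h x = fwd (S n) x.
  move=> Fx; have FE m : F (n + m) x /\ fwd (S (n + m)) x = fwd (S n) x.
    elim: m => [|m [Fm <-]]; first by rewrite addn0.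
    rewrite addnS; split; first exact: F_mono.
    exact: (step_fwd (gS _) (sS _) x).2.
  apply: pre_inj => m; rewrite -(FE m).2.
  exact: pre_le (leq_addl _ _) (hS _ _).
have hF' n x : F n x -> h' x = bwd (S n) x.
  move=> Fx; have FE m : F (n + m) x /\ bwd (S (n + m)) x = bwd (S n) x.
    elim: m => [|m [Fm <-]]; first by rewrite addn0.
    rewrite addnS; split; first exact: F_mono.
    exact: (step_bwd (gS _) (gS _) (sS _) x).2.
  apply: pre_inj => m; rewrite -(FE m).2.
  exact: pre_le (leq_addl _ _) (hS' _ _).
(* A promise survives to stage [n + m] with depth at least [n + m], so [h (src p)] and [tgt p] share
   arbitrarily long prefixes. *)
have hp n p : List.In p (promises (S n)) -> h (src p) = tgt p.
  move=> pL; apply: pre_inj => m.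
  have [q qL [<- <-]] : exists2 q, List.In q (promises (S (n + m))) &
      src q = src p /\ tgt q = tgt p.
    elim: m => [|m [q qL [<- <-]]]; first by rewrite addn0; exists p.
    by rewrite addnS; exact: (s_keep (sS _) qL).
  have v := g_valid (gS _) qL; have mn := leq_addl n m.
  rewrite (pre_le mn (hS _ _)); apply: pre_le (eqP (v_near v)).
  exact: leq_trans mn (v_depth v).
exists h, h'; split=> //; split.
- move=> d /e_surj[n <-]; have [_ _ [p pL]] := HS n.*2.
  rewrite odd_double doubleK => <-; rewrite (hp _ _ pL).
  by have [] := g_valid (gS _) pL.
- move=> d /e_surj[n <-]; have [_ _ [p pL]] := HS n.*2.+1.
  rewrite /= odd_double /= uphalf_double => <-; rewrite -(hp _ _ pL) hK.
  by have [] := g_valid (gS _) pL.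
- by move=> n x /hF ->; exact: th_tail.
- move=> n x /hF' ->; have := th_tail (th n) (bwd (S n) x).
  by rewrite (thK' (th n)); exact: tail_equiv_sym.
Qed.

End BackAndForth.

(** * Prefixes and the topology of the Cantor space *)

Lemma nbhs_cantorP (x : cantor_space) (U : set cantor_space) :
  nbhs x U <-> exists k, forall y, pre k x = pre k y -> U y.
Proof.
split=> [|[k kU]].
  (* The filter of cones at [x] converges to [x] in each coordinate, hence in the product topology;
     so every neighbourhood contains a cone. *)
  pose C := filter_from [set: nat] (fun k => [set y | pre k x = pre k y]).
  have FC : Filter C.
    apply: filter_from_filter; first by exists 0.
    move=> i j _ _; exists (i + j) => // y xy.
    by split; apply: pre_le xy; rewrite ?leq_addr ?leq_addl.
  have : C --> x.
    apply/cvg_sup => i; apply/cvg_image.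
      by rewrite eqEsubset; split=> // b _; exists (fun=> b).
    move=> A /nbhs_singleton Ax; exists ((fun f : point => f i) @^-1` A).
      by exists i.+1 => // y /preP xy; rewrite /= -xy.
    by rewrite eqEsubset; split=> [_ [y Ay <-]//|b Ab]; exists (fun=> b).
  by move=> /(_ U) + Ux => /(_ Ux) [k _ kU]; exists k => y /kU.
suff : nbhs x [set y | pre k x = pre k y] by exact: filterS.
elim: k {kU} => [|k IH]; first exact: filterE.
have xk : nbhs x [set y : cantor_space | x k = y k].
  have := @proj_continuous _ (fun _ : nat => bool) k x.
  move=> /(_ [set x k]) H; apply: filterS (H (discrete_set1 _)).
  by move=> y /= <-.
apply: filterS (filterI IH xk) => y [/preP xy xyk]; apply/preP => i.
by rewrite ltnS leq_eqVlt => /predU1P[->//|/xy].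
Qed.

Lemma continuous_cantorP (g : cantor_space -> cantor_space) :
  continuous g <-> pcontinuous g.
Proof.
split=> cg x.
  move=> m; apply/(nbhs_cantorP x [set y | pre m (g x) = pre m (g y)]).
  by apply: (cg x [set z | pre m (g x) = pre m z]); apply/nbhs_cantorP; exists m.
move=> U /nbhs_cantorP[m mU]; apply/nbhs_cantorP.
by have [k gk] := cg x m; exists k => y /gk /mU.
Qed.

(** * Saturations and countability *)

Lemma saturation_sat A x y : saturation A x -> tail_equiv y x -> saturation A y.
Proof. by move=> [a Aa xa] yx; exists a => //; exact: tail_equiv_trans xa. Qed.

Lemma sub_saturation A : A `<=` saturation A.
Proof. by move=> x Ax; exists x => //; exact: tail_equiv_refl. Qed.

Lemma saturation_sub A B : A `<=` B -> saturation A `<=` saturation B.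
Proof. by move=> AB x [a /AB Ba xa]; exists a. Qed.

Lemma setU_countable T (A B : set T) :
  countable A -> countable B -> countable (A `|` B).
Proof.
by move=> cA cB; rewrite -bigcup2E; apply: bigcup_countable => // -[|[|n]] _ //=.
Qed.

(** A sequence tail equivalent to [a] is a finite word followed by a tail of [a]: it is coded by
    [a], a shift and the word. *)
Lemma countable_saturation A : countable A -> countable (saturation A).
Proof.
move=> cA; pose f (t : (point * nat) * seq bool) : point :=
  fun i => if i < size t.2 then nth false t.2 i
           else t.1.1 (t.1.2 + (i - size t.2)).
have : countable ((A `*` [set: nat]) `*` [set: seq bool]).
  by apply: countableX; [apply: countableX|]; rewrite ?countableP.
apply: sub_countable; apply: card_le_trans (card_image_le f _).
apply: subset_card_le => y [a Aa [m [n ya]]].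
exists ((a, n), pre m y) => //; apply: funext => i; rewrite /f /= size_mkseq.
have [im|mi] := ltnP i m; first by rewrite nth_mkseq.
by rewrite -ya subnKC.
Qed.

Theorem theorem4p1 (X : set cantor_space) :
  ~ countable X -> saturated X -> lambda_set X -> relatively_cdh X.
Proof.
move=> ucX sX lX D0 D1 cD0 [D0X XD0] cD1 [D1X XD1].
pose E := D0 `|` D1.
have cE : countable E by exact: setU_countable.
have [x0 Xx0 nEx0] : exists2 x0, X x0 & ~ saturation E x0.
  apply: contrapT => h; apply: ucX; apply: sub_countable (countable_saturation cE).
  by apply: subset_card_le => x Xx; apply: contrapT => nE; apply: h; exists x.
pose D := saturation (E `|` [set x0]).
have DX : D `<=` X.
  by rewrite sX; apply: saturation_sub => x [[/D0X|/D1X]|->].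
have ED : E `<=` D by move=> x Ex; apply: sub_saturation; left.
have cD : countable D.
  by apply/countable_saturation/setU_countable => //; exact: countable1.
have D_sat x y : D x -> tail_equiv y x -> D y by exact: saturation_sat.
have [G [A oA ->] DG] := lX D DX cD.
(* The complements of the open sets [A 0] to [A n], united: closed, increasing in [n] and disjoint
   from [D]. *)
pose F n : set point := [set x | exists2 i, i <= n & ~ A i x].
have F_away n d : D d -> exists k, forall x, pre k d = pre k x -> ~ F n x.
  rewrite DG => -[Xd Ad].
  have Ak i : exists k, forall x, pre k d = pre k x -> A i x.
    by apply/nbhs_cantorP/open_nbhs_nbhs; split; [exact: oA|exact: Ad].
  elim: n => [|n [k kF]].
    have [k kA] := Ak 0; exists k => x /kA Ax [i].
    by rewrite leqn0 => /eqP -> /(_ Ax).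
  have [l lA] := Ak n.+1; exists (k + l) => x dx [i].
  rewrite leq_eqVlt => /predU1P[->|ni] nA.
    by apply/nA/lA; exact: pre_le (leq_addl _ _) dx.
  by apply: (kF x); [exact: pre_le (leq_addr _ _) dx|exists i].
(* Both cases use [splice k x x0], tail equivalent to [x0]. It lies in [X], so [B] has points in its
   cone; it also lies in [D] but not in [E], since [x0] avoids the saturation of [E]. *)
have dense B : B `<=` E -> X `<=` closure B -> forall k x (b : Prop),
    exists y, [/\ D y, B y <-> b & pre k x = pre k y].
  move=> BE XB k x b; have [bT|bF] := pselect b.
    have : X (splice k x x0).
      by rewrite sX; exists x0 => //; exact: tail_equiv_splice.
    move=> /XB /(_ [set y | pre k x = pre k y]) [].
      by apply/nbhs_cantorP; exists k => y; rewrite pre_splice.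
    by move=> y [By xy]; exists y; split=> //; apply: ED; exact: BE.
  exists (splice k x x0); split; last by rewrite pre_splice.
    by exists x0; [right|exact: tail_equiv_splice].
  split=> // /BE Ey; exfalso; apply: nEx0; exists (splice k x x0) => //.
  by apply: tail_equiv_sym; exact: tail_equiv_splice.
have /countable_injP[f finj] := cD.
(* The default [x0], taken at codes that [f] does not attain on [D], is itself in [D], so [e] never
   leaves [D]. *)
pose e n := xget x0 [set d | D d /\ f d = n].
have Dx0 : D x0 by apply: sub_saturation; right.
have e_D n : D (e n) by rewrite /e; case: xgetP => [_ -> []|].
have e_surj d : D d -> exists n, e n = d.
  move=> Dd; exists (f d); rewrite /e; case: xgetP => [y -> [Dy fy]|/(_ d)[]//].
  by apply: finj fy; rewrite ?inE.
have F_mono n : F n `<=` F n.+1.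
  by move=> x [i ni Ai]; exists i => //; exact: leqW.
have [h [h' [[hK hK' ch ch'] [hD h'D hF hF']]]] := back_and_forth_limit D_sat
  F_mono F_away (dense D0 (@subsetUl _ _ _) XD0) (dense D1 (@subsetUr _ _ _) XD1)
  e_D e_surj.
have XDF x : X x -> D x \/ exists n, F n x.
  move=> Xx; have [Dx|nDx] := pselect (D x); [by left|right].
  apply: contrapT => nF; apply: nDx; rewrite DG; split=> // i _.
  by apply: contrapT => nA; apply: nF; exists i, i.
have Xtail x y : X x -> tail_equiv y x -> X y by rewrite sX; exact: saturation_sat.
have hX x : X x -> X (h x).
  by move=> Xx; have [/hD[/DX]|[n /hF]] := XDF x Xx => //; exact: Xtail.
have h'X x : X x -> X (h' x).
  by move=> Xx; have [/h'D/DX|[n /hF']] := XDF x Xx => //; exact: Xtail.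
exists h; split.
- split; first exact/continuous_cantorP.
  by exists h'; split=> //; exact/continuous_cantorP.
- rewrite eqEsubset; split=> [_ [d Dd <-]|d Dd].
    by have [_ [+ _]] := hD d (ED d (or_introl Dd)); apply.
  (* As [h' d] lies in [D] and is sent to [d] in [D1], preservation of types puts it in [D0]. *)
  exists (h' d); last exact: hK'.
  by have [_ [_]] := hD _ (h'D d (ED d (or_intror Dd))); rewrite hK'; apply.
- rewrite eqEsubset; split=> [_ [x Xx <-]|x Xx]; first exact: hX.
  by exists (h' x); [exact: h'X|exact: hK'].
Qed.
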